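(* Assume $\|\rho_i\|:=\sup_{x_i,z_i\in\mathsf{X}_i}\rho_i(x_i,z_i)<\infty$ for all $i\in T$. Suppose that the Borel probability measure $\mu$ on $\mathsf{X}$ satisfies the Dobrushin uniqueness condition, i.e., the spectral radius of its Dobrushin interdependence matrix $C^\mu$ is strictly smaller than unity. Let $D^\mu:=\sum_{m=0}^\infty(C^\mu)^m$ and $$\Gamma_{ij}:=\|\rho_i\|\,\big((D^\mu)^{\mathsf T}\big)_{ij}=\|\rho_i\|\,D^\mu_{ji},\qquad i,j\in T.$$ Then, for any measurable $f:\mathsf{X}\to\mathbb{R}$ that is Lipschitz with respect to $\rho$ and for any $t\ge 0$, $$\mathbb{P}_\mu\Big\{|f(X)-\mathbb{E}_\mu[f(X)]|\ge t\Big\}\le 2\exp\left(-\frac{2t^2}{\|\Gamma\boldsymbol{\delta}(f)\|^2_{\ell^2(T)}}\right).$$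
   Context: Let $T=\{1,\dots,n\}$. For each $i\in T$, $\mathsf{X}_i$ is a Polish space with Borel $\sigma$-field $\mathcal{B}_i$ and a lower-semicontinuous metric $\rho_i$ on $\mathsf{X}_i$ (not necessarily the one metrizing the topology). $\mathsf{X}=\prod_{i\in T}\mathsf{X}_i$ with the product $\sigma$-field and metric $\rho(x,z)=\sum_{i\in T}\rho_i(x_i,z_i)$. For $I\subseteq T$, $x^I$ denotes the restriction of $x$ to the coordinates in $I$. $X=(X_i)_{i\in T}$ is a random element of $\mathsf{X}$ with law $\mu$, and $\mu_i(\cdot|x^{T\setminus\{i\}})$ is the regular conditional law of $X_i$ given $X^{T\setminus\{i\}}=x^{T\setminus\{i\}}$ (a fixed version). $W_i$ is the $L^1$ Wasserstein distance on $\mathsf{X}_i$ for the metric $\rho_i$: $W_i(\eta,\eta')=\inf_{\mathbf{P}}\mathbb{E}_{\mathbf{P}}[\rho_i(Y,Y')]$ over all couplings $\mathbf{P}$ of $\eta$ and $\eta'$. The Dobrushin interdependence matrix $C^\mu=(C^\mu_{ij})_{i,j\in T}$ of $\mu$ is $$C^\mu_{ij}=\sup_{x,z\in\mathsf{X}:\ x^{T\setminus\{j\}}=z^{T\setminus\{j\}}}\frac{W_i\big(\mu_i(\cdot|x^{T\setminus\{i\}}),\mu_i(\cdot|z^{T\setminus\{i\}})\big)}{\rho_j(x_j,z_j)},\qquad 0/0=0$$ (with finite entries). The local oscillation of a measurable $f:\mathsf{X}\to\mathbb{R}$ at $i$ is $$\delta_i(f)=\sup_{x,z\in\mathsf{X}:\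 x^{T\setminus\{i\}}=z^{T\setminus\{i\}}}\frac{|f(x)-f(z)|}{\rho_i(x_i,z_i)},\qquad 0/0=0,$$ and $\boldsymbol{\delta}(f)=(\delta_i(f))_{i\in T}$. *)

(* Defs.v *)
From HB Require Import structures.
From mathcomp Require Import all_boot all_order all_algebra.
From mathcomp Require Import all_classical all_reals all_analysis.
From mathcomp Require Import complex.

Set Implicit Arguments.
Unset Strict Implicit.
Unset Printing Implicit Defensive.

Import Order.TTheory GRing.Theory Num.Theory.
Import numFieldNormedType.Exports.

Local Open Scope classical_set_scope.
Local Open Scope ring_scope.

Section Metrics.
Variable R : realType.

Definition is_metric (T : Type) (d : T -> T -> R) : Prop :=
  [/\ forall x y, 0 <= d x y,
      forall x y, d x y = 0 <-> x = y,
      forall x y, d x y = d y x &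
      forall x y z, d x z <= d x y + d y z].

Definition metrizes (T : topologicalType) (d : T -> T -> R) : Prop :=
  forall (x : T) (A : set T),
    nbhs x A <-> exists2 e : R, 0 < e & [set y | d x y < e] `<=` A.

Definition metric_complete (T : topologicalType) (d : T -> T -> R) : Prop :=
  forall u : nat -> T,
    (forall e : R, 0 < e -> exists N : nat, forall p q : nat,
       (N <= p)%N -> (N <= q)%N -> d (u p) (u q) < e) ->
    exists l : T, u @ \oo --> l.

Definition polish (T : topologicalType) : Prop :=
  (exists2 D : set T, countable D & dense D) /\
  (exists d : T -> T -> R, [/\ is_metric d, metrizes d & metric_complete d]).

(* Joint lower semicontinuity, on the product space T * T. *)
Definition lsc_metric (T : topologicalType) (rho : T -> T -> R) : Prop :=
  is_metric rho /\
  lower_semicontinuous (fun p : T * T => (rho p.1 p.2)%:E).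

Definition metric_diam (T : Type) (rho : T -> T -> R) : \bar R :=
  ereal_sup [set (rho p.1 p.2)%:E | p in [set: T * T]].

End Metrics.

Notation borel T := (g_sigma_algebraType (@open T)).

(* Measurable sets for a single coordinate; their union over the coordinates
   generates the product sigma-field. *)
Definition cylinders (I : Type) (X : I -> ptopologicalType) :
    set (set (forall i, X i)) :=
  \bigcup_i [set (fun x : forall i, X i => x i) @^-1` A |
              A in (measurable : set (set (borel (X i))))].

Arguments cylinders {I} X.

Notation prod_space X := (g_sigma_algebraType (cylinders X)).

Section Wasserstein.
Variables (R : realType) (T : ptopologicalType).

Definition is_coupling (P : probability (borel T * borel T)%type R)
    (eta eta' : set (borel T) -> \bar R) : Prop :=
  forall A : set (borel T), measurable A ->
    P (A `*` setT) = eta A /\ P (setT `*` A) = eta' A.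

Definition wasserstein1 (rho : T -> T -> R)
    (eta eta' : set (borel T) -> \bar R) : \bar R :=
  ereal_inf [set (\int[P]_p (rho p.1 p.2)%:E)%E |
              P in [set P | is_coupling P eta eta']].

End Wasserstein.

Section Dobrushin.
Variables (R : realType) (n : nat) (X : 'I_n -> ptopologicalType).
Variable rho : forall i, X i -> X i -> R.

Local Notation cproj I := (fun k : {j : 'I_n | j \in (I : {set 'I_n})} =>
  X (sval k)).

Definition restr (I : {set 'I_n}) (x : forall i, X i) :
    forall k : {j : 'I_n | j \in I}, X (sval k) :=
  fun k => x (sval k).
Arguments restr I x k : clear implicits.

Definition off (i : 'I_n) : {set 'I_n} := (~: [set i])%SET.

(* k is a version of the regular conditional law of the i-th coordinate given
   the other ones, under mu. *)
Definition is_cond_law (mu : probability (prod_space X) R) (i : 'I_n)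
    (k : R.-pker prod_space (cproj (off i)) ~> borel (X i)) : Prop :=
  forall (A : set (borel (X i))) (B : set (prod_space (cproj (off i)))),
    measurable A -> measurable B ->
    mu [set x | A (x i) /\ B (restr (off i) x)] =
    (\int[mu]_(x in [set x | B (restr (off i) x)])
       k (restr (off i) x) A)%E.

Definition cond_laws := forall i : 'I_n,
  R.-pker prod_space (cproj (off i)) ~> borel (X i).

(* 0^-1 = 0 in R, so both quotients below satisfy 0 / 0 = 0.  A vanishing
   denominator forces x = z, hence a vanishing numerator. *)
Definition dobrushin_coef (k : cond_laws) (i j : 'I_n) : \bar R :=
  ereal_sup [set (wasserstein1 (@rho i) (k i (restr (off i) p.1))
                    (k i (restr (off i) p.2)) *
                  ((rho (p.1 j) (p.2 j))^-1)%:E)%E |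
    p in [set p : (forall i, X i) * (forall i, X i) |
            restr (off j) p.1 = restr (off j) p.2]].

Definition local_osc (f : (forall i, X i) -> R) (i : 'I_n) : \bar R :=
  ereal_sup [set (`|f p.1 - f p.2| / rho (p.1 i) (p.2 i))%:E |
    p in [set p : (forall i, X i) * (forall i, X i) |
            restr (off i) p.1 = restr (off i) p.2]].

Definition rho_sum (x z : forall i, X i) : R := \sum_i rho (x i) (z i).

Definition rho_lipschitz (f : (forall i, X i) -> R) : Prop :=
  exists L : R, forall x z, `|f x - f z| <= L * rho_sum x z.

(* The [fine] projections below are only used when the projected extended
   real is finite: by assumption for the Dobrushin coefficients and the
   diameters, and by the Lipschitz property for the oscillations. *)
Definition dobrushin_mx (k : cond_laws) : 'M[R]_n :=
  \matrix_(i, j) fine (dobrushin_coef k i j).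

Definition osc_vec (f : (forall i, X i) -> R) : 'cV[R]_n :=
  \col_i fine (local_osc f i).

(* Sum of all powers of C, with entrywise convergence. *)
Definition neumann_mx (C : 'M[R]_n) : 'M[R]_n :=
  \matrix_(i, j) limn (series (fun m : nat => (C ^+ m) i j)).

Definition Gamma_mx (k : cond_laws) : 'M[R]_n :=
  \matrix_(i, j) (fine (metric_diam (@rho i)) *
                  (neumann_mx (dobrushin_mx k))^T i j).

End Dobrushin.

Section Linear.
Variables (R : realType) (n : nat).

(* Largest modulus of a complex eigenvalue. *)
Definition spectral_radius (A : 'M[R]_n) : R :=
  sup [set Normc.normc lambda |
        lambda in [set l : R[i] |
                    eigenvalue (map_mx (real_complex R) A) l]].

(* The tail bound divides by the square of this norm in \bar R, where
   0^-1 = +oo: for a zero norm the bound is 0 if t > 0 and 2 if t = 0. *)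
Definition l2norm (v : 'cV[R]_n) : R := Num.sqrt (\sum_i v i 0 ^+ 2).

End Linear.

(* Main.v *)
Require Import Defs.
From HB Require Import structures.
From mathcomp Require Import all_boot all_order all_algebra.
From mathcomp Require Import all_classical all_reals all_analysis.
From mathcomp Require Import measurable_realfun giry complex ring lra.

(** Let [C] be the interdependence matrix, [D] its Neumann series, and [a] a
    row vector of oscillation bounds of a function [h]. Averaging [h] over the
    conditional law of the [i]-th coordinate preserves the expectation and, by
    the easy half of Kantorovich duality, replaces [a] by [a - a_i e_i (1 - C)].
    As [(1 - C) D = 1], this lowers the [i]-th entry of [a D] by [a_i] and leaves
    the other entries unchanged. Hence finitely many such averagings at
    coordinates [i >= m] make all the oscillations at these coordinates smaller
    than [eps] without increasing [a D]. The result is an everywhere-defined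
    approximation of the conditional expectation given the first [m]
    coordinates, so that no disintegration of [mu] is needed.

    Letting [m] decrease from [n] to [0] yields an approximate martingale whose
    [m]-th increment ranges, once the first [m] coordinates are fixed, over an
    interval of length [||rho_m|| (delta(f) D)_m + O(eps)], which is
    [(Gamma delta(f))_m + O(eps)]. Hoeffding's lemma, applied pointwise to the
    averaging operators, bounds the Laplace transform of [f] and Chernoff's
    bound concludes.

    The Neumann series converges because, by Cayley-Hamilton, the powers of [C]
    satisfy a linear recurrence whose characteristic roots have modulus less
    than [1]. *)

Import Order.TTheory GRing.Theory Num.Theory.
Import numFieldNormedType.Exports.
Local Open Scope classical_set_scope.
Local Open Scope ring_scope.

Set Implicit Arguments.
Unset Strict Implicit.
Unset Printing Implicit Defensive.

(** * Neumann series *)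

Section Neumann.

(** Sum the triangle inequality for [u m.+1 = (u m.+1 - l * u m) + l * u m] over [m] and solve for
    the sum of norms, which [|l| < 1] allows. *)
Lemma sum_norm_recurrence (F : numFieldType) (l : F) (u : nat -> F) (W : F) :
  `|l| < 1 -> (forall M, \sum_(m < M) `|u m.+1 - l * u m| <= W) ->
  forall M, \sum_(m < M) `|u m| <= (`|u 0%N| + W) / (1 - `|l|).
Proof.
move=> l1 uW M; rewrite ler_pdivlMr ?subr_gt0// mulrBr mulr1 lerBlDr.
case: M => [|M].
  by rewrite big_ord0 mul0r addr0 addr_ge0// (le_trans _ (uW 0%N))// big_ord0.
rewrite big_ord_recl [X in X <= _]/= -!addrA lerD2l.
apply: (@le_trans _ _ (\sum_(m < M) (`|u m.+1 - l * u m| + `|u m| * `|l|))).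
  apply: ler_sum => m _; rewrite [_ * `|l|]mulrC -normrM.
  by apply: le_trans (ler_normD _ _); rewrite subrK.
rewrite big_split/= -mulr_suml lerD ?uW// ler_wpM2r//.
by rewrite -(big_ord_recl M (fun m => `|u m|)) big_ord_recr/= lerDl.
Qed.

(** Linear factors are peeled off one at a time: each yields a first-order recurrence for the
    entries of [Q * A ^+ m], with a forcing term already known to be summable. *)
Lemma mx_powers_sum_bounded (F : numFieldType) (n : nat) (A : 'M[F]_n.+1)
    (s : seq F) : all (fun l => `|l| < 1) s ->
  \prod_(l <- s) (A - l%:M) = 0 ->
  forall i j, exists W, forall M, \sum_(m < M) `|(A ^+ m) i j| <= W.
Proof.
move=> s1 sA i j.
(* The left factor [Q] absorbs linear factors during the induction; for [Q = 1] the premise is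
   trivial because the whole product vanishes. *)
suff: forall Q, (exists W, forall M,
    \sum_(m < M) `|(Q * \prod_(l <- s) (A - l%:M) * A ^+ m) i j| <= W) ->
  exists W, forall M, \sum_(m < M) `|(Q * A ^+ m) i j| <= W.
  move=> /(_ 1); rewrite sA mulr0 => -[|W hW].
    by exists 0 => M; rewrite big1// => m _; rewrite mul0r mxE normr0.
  by exists W => M; under eq_bigr do rewrite -[_ ^+ _]mul1r.
elim: s s1 {sA} => [|l s ih] /=.
  by move=> _ Q; rewrite big_nil mulr1.
move=> /andP[l1 /ih{}ih] Q [W]; rewrite big_cons mulrA => hW.
have [W' hW'] := ih (Q * (A - l%:M)) (ex_intro _ W hW).
pose u m := (Q * A ^+ m) i j.
exists ((`|u 0%N| + W') / (1 - `|l|)).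
apply: (@sum_norm_recurrence _ l u W') => // M.
apply: le_trans (hW' M); apply: ler_sum => m _; rewrite /u.
suff -> : Q * (A - l%:M) * A ^+ m = Q * A ^+ m.+1 - l *: (Q * A ^+ m).
  have E (P P' : 'M[F]_n.+1) : (P - l *: P') i j = P i j - l * P' i j.
    by rewrite !mxE.
  by rewrite E.
rewrite mulrBr mulrBl exprS mulrA; congr (_ - _).
by rewrite -!mulmxE mul_mx_scalar scalemxAl.
Qed.

Lemma eigenvalue_norm_le_spectral_radius (R : realType) (n : nat) (A : 'M[R]_n)
    (l : R[i]) : eigenvalue (map_mx (real_complex R) A) l ->
  Normc.normc l <= spectral_radius A.
Proof.
move=> Al; apply: ub_le_sup; last by exists l.
have [r pr] := closed_field_poly_normal (char_poly (map_mx (real_complex R) A)).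
(* The supremum is an upper bound only if the set is bounded above; the sum of the moduli of all
   characteristic roots bounds it. *)
exists (\sum_(z <- r) Normc.normc z) => _ [z + <-] /=.
rewrite /mkset eigenvalue_root_char pr (monicP (char_poly_monic _)) scale1r.
rewrite root_prod_XsubC => zr.
have n0 (w : R[i]) : 0 <= Normc.normc w by case: w => a b; rewrite sqrtr_ge0.
by rewrite (big_rem z)//= lerDl sumr_ge0.
Qed.

Lemma spectral_radius_powers_sum_bounded (R : realType) (n : nat) (A : 'M[R]_n) :
  spectral_radius A < 1 ->
  forall i j, exists W, forall M, \sum_(m < M) `|(A ^+ m) i j| <= W.
Proof.
case: n A => [A _ []//|n A sA i j].
pose AC := map_mx (real_complex R) A.
have [r pr] := closed_field_poly_normal (char_poly AC).
rewrite (monicP (char_poly_monic _)) scale1r in pr.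
have r1 : all (fun l => `|l| < 1) r.
  apply/allP => z zr.
  have : eigenvalue AC z by rewrite eigenvalue_root_char pr root_prod_XsubC.
  move=> /eigenvalue_norm_le_spectral_radius /le_lt_trans/(_ sA).
  by rewrite -ltcR; case: (z).
have r0 : \prod_(l <- r) (AC - l%:M) = 0.
  rewrite -(Cayley_Hamilton AC) pr rmorph_prod/=.
  by apply: eq_bigr => z _; rewrite rmorphB/= horner_mx_X horner_mx_C.
have [W hW] := mx_powers_sum_bounded r1 r0 i j.
(* [W] is complex but nonnegative, hence real, so its real part is a real bound. *)
exists (complex.Re W) => M; rewrite -lecR; apply: le_trans (_ : W <= _).
  apply: le_trans (hW M); rewrite raddf_sum/=; apply: ler_sum => m _.
  have -> : AC ^+ m = map_mx (real_complex R) (A ^+ m) by rewrite rmorphXn.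
  by rewrite [in leRHS]mxE normc_def/= expr0n addr0 sqrtr_sqr.
have : 0 <= W by apply: le_trans (hW 0%N); rewrite big_ord0.
by case: (W) => a b; rewrite !lecE/= => /andP[/eqP-> _]; rewrite eqxx lexx.
Qed.

Variables (R : realType) (n : nat) (C : 'M[R]_n).
Hypotheses (C0 : forall i j, 0 <= C i j) (C1 : spectral_radius C < 1).

Let pow_ge0 m i j : 0 <= (C ^+ m) i j.
Proof.
elim: m i j => [|m ih] i j; first by rewrite expr0 !mxE ler0n.
by rewrite exprS mxE sumr_ge0// => l _; rewrite mulr_ge0.
Qed.

Let cvgn_neumann i j : cvgn (series (fun m => (C ^+ m) i j)).
Proof.
have [W hW] := spectral_radius_powers_sum_bounded C1 i j.
apply: nondecreasing_is_cvgn.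
  by apply: nondecreasing_series => m _ _; exact: pow_ge0.
exists W => _ [M _ <-]; apply: le_trans (hW M).
by rewrite /series/= big_mkord ler_sum// => m _; rewrite ler_norm.
Qed.

(** Limit of the identity [S_(M+1) = 1 + C S_M] between partial sums. *)
Lemma neumann_mx_fixpoint : neumann_mx C = 1%:M + C *m neumann_mx C.
Proof.
apply/matrixP => i j; rewrite !mxE; apply/cvg_lim => //.
rewrite -(cvg_shiftS (series _)) /=.
rewrite [X in X @ _ --> _](_ : _ =
    (fun M => (i == j)%:R + \sum_l C i l * series (fun m => (C ^+ m) l j) M)).
  apply: cvgD; first exact: cvg_cst.
  apply: cvg_big => [|l _]; first exact: add_continuous.
  apply: cvgM; first exact: cvg_cst.
  by rewrite mxE; exact: cvgn_neumann.
apply/funext => M; rewrite /series/= big_nat_recl// expr0 mxE; congr (_ + _).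
under eq_bigr do rewrite exprS mxE.
by rewrite exchange_big/=; under eq_bigr do rewrite -mulr_sumr.
Qed.

Lemma neumann_mx_ge0 i j : 0 <= neumann_mx C i j.
Proof.
rewrite mxE; apply: limr_ge => //; apply: nearW => M.
by apply: sumr_ge0 => m _; exact: pow_ge0.
Qed.

End Neumann.

(** * Hoeffding's lemma *)

Section Hoeffding.
Variable R : realType.
Implicit Types (u th a b p : R).

(** The logistic function takes the value [th] at [0] and has derivative [p (1 - p) <= 1 / 4], where
    [p] is its value; the mean value theorem concludes. *)
Let logistic_le u th : 0 <= th <= 1 -> 0 <= u ->
  th * expR u / (1 - th + th * expR u) <= th + u / 4.
Proof.
move=> /andP[th0 th1] u0.
have den0 v : 0 < 1 - th + th * expR v.
  have := expR_gt0 v; nra.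
pose f (v : R) : R := th * expR v / (1 - th + th * expR v).
pose df (v : R) : R := (1 - th) * (th * expR v) / (1 - th + th * expR v) ^+ 2.
have fdf (v : R) : is_derive v 1 f (df v).
  rewrite /f; apply: is_derive_eq.
    apply: is_deriveM; apply: is_deriveV; first by rewrite gt_eqF.
  rewrite /df /GRing.scale/=; field; rewrite gt_eqF//.
have cf : {within `[0, u], continuous f}.
  by apply: derivable_within_continuous => x _; have [] := fdf x.
have [c _] := @MVT_segment R f df 0 u u0 (fun x _ => fdf x) cf.
rewrite /f expR0 subr0 mulr1 subrK divr1 => /eqP; rewrite subr_eq => /eqP->.
rewrite addrC lerD2l [leRHS]mulrC ler_wpM2r//.
rewrite /df ler_pdivrMr ?exprn_gt0//.
have := sqr_ge0 (1 - th - th * expR c); nra.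
Qed.

(** After taking logarithms, the difference of the two sides vanishes at [0] and has a nonnegative
    derivative by [logistic_le]. *)
Let hoeffding_bernoulli_pos th u : 0 <= th <= 1 -> 0 <= u ->
  1 - th + th * expR u <= expR (th * u + u ^+ 2 / 8).
Proof.
move=> th01 u0; have /andP[th0 th1] := th01.
have den0 v : 0 < 1 - th + th * expR v.
  have := expR_gt0 v; nra.
rewrite -ler_ln ?posrE ?expR_gt0// expRK.
pose f (v : R) : R := th * v + v ^+ 2 / 8 - ln (1 - th + th * expR v).
pose df (v : R) : R := th + v / 4 - th * expR v / (1 - th + th * expR v).
have fdf (v : R) : is_derive v 1 f (df v).
  rewrite /f; have := is_derive1_ln (den0 v) => dln.
  apply: is_derive_eq.
  rewrite /df /GRing.scale/=; field; rewrite gt_eqF//.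
have cf : {within `[0, u], continuous f}.
  by apply: derivable_within_continuous => x _; have [] := fdf x.
have [c] := @MVT_segment R f df 0 u u0 (fun x _ => fdf x) cf.
rewrite in_itv/= => /andP[c0 _].
rewrite {2}/f expR0 mulr1 subrK ln1 !(mulr0, expr0n, mul0r, subr0, addr0)/=.
move=> fE; rewrite -subr_ge0 -/(f u) fE mulr_ge0// subr_ge0.
exact: logistic_le.
Qed.

Lemma hoeffding_bernoulli th u : 0 <= th <= 1 ->
  1 - th + th * expR u <= expR (th * u + u ^+ 2 / 8).
Proof.
move=> th01; have [|u0] := leP 0 u; first exact: hoeffding_bernoulli_pos.
(* For [u < 0], exchange the two outcomes: factoring out [expR u] leaves the parameters [1 - th] and
   [- u]. *)
have h : 0 <= 1 - th <= 1 by lra.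
have := hoeffding_bernoulli_pos h (_ : 0 <= - u).
rewrite oppr_ge0 => /(_ (ltW u0)) {}h.
have -> : th * u + u ^+ 2 / 8 = u + ((1 - th) * - u + (- u) ^+ 2 / 8) by field.
rewrite expRD; apply: le_trans (ler_wpM2l (expR_ge0 u) h).
by rewrite mulrDr mulrCA -expRD subrr expR0; lra.
Qed.

(* Hoeffding's lemma in a form that transfers to any positive normalised
   functional by monotonicity alone. *)
Lemma expR_affine_majorant l a b p c : a <= p <= b -> b - a <= c ->
  exists al be : R,
    (forall y, a <= y <= b -> expR (l * y) <= al + be * y) /\
    al + be * p <= expR (l * p + l ^+ 2 * c ^+ 2 / 8).
Proof.
move=> /andP[ap pb] bac; have [ab|ba] := ltP a b; last first.
  have {ap pb ba bac} [-> ->] : p = a /\ b = a by split; lra.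
  exists (expR (l * a)), 0; split=> [y /le_anti->|].
    by rewrite mul0r addr0.
  by rewrite mul0r addr0 ler_expR lerDl divr_ge0// mulr_ge0// sqr_ge0.
have d0 : 0 < b - a by rewrite subr_gt0.
have dN0 : b - a != 0 by rewrite gt_eqF.
(* [w y] is the weight of [b] in [y] as a convex combination of [a] and [b]; the majorant is the
   chord of [expR (l * y)] over [[a, b]]. *)
pose w y := (y - a) / (b - a).
pose ea := expR (l * a); pose eb := expR (l * b).
exists (ea - (eb - ea) * a / (b - a)), ((eb - ea) / (b - a)).
have chordE y : ea - (eb - ea) * a / (b - a) + (eb - ea) / (b - a) * y =
    (1 - w y) * ea + w y * eb by rewrite /w; field.
have w01 y : a <= y <= b -> 0 <= w y <= 1.
  move=> /andP[ay yb]; rewrite /w divr_ge0 ?subr_ge0// ?(ltW ab)//=.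
  by rewrite ler_pdivrMr// mul1r lerD2r.
split=> [y yab|]; rewrite chordE.
  have lyE : l * y = (1 - w y) * (l * a) + w y * (l * b) by rewrite /w; field.
  have /andP[w0 w1] := w01 _ yab.
  (* Convexity by hand: the tangent at [l * y], averaged over the two endpoints with weights
     [1 - w y] and [w y], gives back [expR (l * y)]. *)
  have tangent z : expR (l * y) * (1 + (z - l * y)) <= expR z.
    have -> : expR z = expR (l * y) * expR (z - l * y).
      by rewrite -expRD; congr expR; ring.
    by rewrite ler_wpM2l ?expR_ge0// expR_ge1Dx.
  have := ler_wpM2l w0 (tangent (l * b)).
  have := ler_wpM2l (_ : 0 <= 1 - w y) (tangent (l * a)).
  rewrite subr_ge0 => /(_ w1); rewrite -/ea -/eb => ha hb.
  apply: le_trans (lerD ha hb); rewrite le_eqVlt; apply/orP; left; apply/eqP.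
  by move: (expR (l * y)) => E; rewrite lyE; ring.
(* Dividing by [ea] leaves the Bernoulli bound with [th = w p] and [u = l * (b - a)]. *)
have -> : eb = ea * expR (l * (b - a)) by rewrite /eb -expRD; congr expR; ring.
rewrite mulrCA [in X in X + _]mulrC -mulrDr -ler_pdivlMl ?expR_gt0//.
apply: le_trans (hoeffding_bernoulli _ (w01 p _)) _; first by rewrite ap.
rewrite -expRN -expRD ler_expR.
have : l ^+ 2 * (b - a) ^+ 2 <= l ^+ 2 * c ^+ 2.
  by rewrite ler_wpM2l ?sqr_ge0// lerXn2r ?nnegrE ?(ltW d0)// (le_trans (ltW d0)).
have -> : w p * (l * (b - a)) = l * p - l * a by rewrite /w; field.
by rewrite exprMn; lra.
Qed.

End Hoeffding.

(** * Bounded measurable functions and Wasserstein distance *)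

Section BoundedMeasurable.
Context d (T : measurableType d) (R : realType).
Implicit Types (h : T -> R) (P : probability T R).

Definition bounded_measurable h :=
  measurable_fun setT h /\ exists M, forall x, `|h x| <= M.

Lemma bounded_measurable_integrable P h :
  bounded_measurable h -> P.-integrable setT (EFin \o h).
Proof.
move=> [mh [M hM]]; apply: measurable_bounded_integrable => //.
  by rewrite -ge0_fin_numE// fin_num_measure.
by exists M; split; [exact: num_real|move=> N MN x _; exact: le_trans (ltW MN)].
Qed.

Lemma bounded_measurable_cst (c : R) : bounded_measurable (fun=> c).
Proof. by split; [exact: measurable_cst|exists `|c|]. Qed.

Lemma bounded_measurable_affine (a b : R) h :
  bounded_measurable h -> bounded_measurable (fun x => a + b * h x).
Proof.
move=> [mh [M hM]]; split.
  by apply: measurable_funD => //; exact: measurable_funM.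
exists (`|a| + `|b| * M) => x.
by rewrite (le_trans (ler_normD _ _))// lerD2l normrM ler_wpM2l.
Qed.

Lemma bounded_measurable_expR (l : R) h :
  bounded_measurable h -> bounded_measurable (fun x => expR (l * h x)).
Proof.
move=> [mh [M hM]]; split.
  by apply: measurableT_comp => //; exact: measurable_funM.
exists (expR (`|l| * M)) => x; rewrite ger0_norm ?expR_ge0// ler_expR.
by rewrite (le_trans (ler_norm _))// normrM ler_wpM2l.
Qed.

Lemma Rintegral_probability_cst P (c : R) : \int[P]_x c = c.
Proof. by rewrite Rintegral_cst//= probability_setT mulr1. Qed.

Lemma Rintegral_affine P (a b : R) h : bounded_measurable h ->
  \int[P]_x (a + b * h x) = a + b * \int[P]_x h x.
Proof.
move=> bh; have ih := bounded_measurable_integrable P bh.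
have ibh := bounded_measurable_integrable P (bounded_measurable_affine 0 b bh).
rewrite RintegralD//.
- by rewrite Rintegral_probability_cst RintegralZl.
- exact: (bounded_measurable_integrable P (bounded_measurable_cst a)).
- by move: ibh; congr (integrable _ _ _); apply/funext => x /=; rewrite add0r.
Qed.

Lemma Rintegral_dist_le P (c : R) h h' :
  bounded_measurable h -> bounded_measurable h' ->
  (forall x, `|h x - h' x| <= c) -> `|\int[P]_x h x - \int[P]_x h' x| <= c.
Proof.
move=> bh bh' hh'.
have ih := bounded_measurable_integrable P bh.
have ih' := bounded_measurable_integrable P bh'.
have bB : bounded_measurable (fun x => `|h x - h' x|).
  split; last by exists c => x; rewrite normr_id.
  apply: measurableT_comp => //.
  by apply: measurable_funB; [case: bh|case: bh'].
rewrite -RintegralB// (le_trans (le_normr_Rintegral _ _))//.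
  by have := integrableB measurableT ih ih'.
rewrite -[leRHS](Rintegral_probability_cst P) le_Rintegral//.
- exact: bounded_measurable_integrable.
- exact: (bounded_measurable_integrable P (bounded_measurable_cst c)).
Qed.

Lemma Rintegral_fineK P h : bounded_measurable h ->
  (\int[P]_x (h x)%:E)%E = (\int[P]_x h x)%:E.
Proof.
move=> bh; rewrite /Rintegral fineK//; apply: integrable_fin_num => //.
exact: bounded_measurable_integrable.
Qed.

End BoundedMeasurable.

(* [f2] need not be measurable: the integral of a nonnegative function is a
   supremum over the simple functions below it. *)
Lemma ge0_le_lower_integral d (T : measurableType d) (R : realType)
    (m : {measure set T -> \bar R}) (f1 f2 : T -> \bar R) :
  (forall x, 0 <= f1 x)%E -> (forall x, f1 x <= f2 x)%E ->
  (\int[m]_x f1 x <= \int[m]_x f2 x)%E.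
Proof.
move=> f10 f12; rewrite !ge0_integralTE//; last first.
  by move=> x; exact: le_trans (f10 x) (f12 x).
by apply: ereal_sup_le => _ [h hf1 <-]; exists h => // x; exact: le_trans (f12 x).
Qed.

(* The easy half of Kantorovich-Rubinstein duality. *)
Lemma wasserstein1_dual (R : realType) (T : ptopologicalType)
    (rho : T -> T -> R) (eta eta' : probability (borel T) R)
    (g : borel T -> R) (a : R) :
  (forall y z, 0 <= rho y z) -> bounded_measurable g -> 0 <= a ->
  (forall y z, `|g y - g z| <= a * rho y z) ->
  (`|\int[eta]_y g y - \int[eta']_y g y|%:E
    <= a%:E * wasserstein1 rho eta eta')%E.
Proof.
move=> rho0 bg; rewrite le_eqVlt => /predU1P[<- g0|a0 ga].
  (* For [a = 0] one cannot divide by [a], but [g] is constant and [0 * W = 0] even for infinite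
     [W]. *)
  have -> : g = fun=> g point.
    apply/funext => y; apply/eqP; rewrite -subr_eq0 -normr_le0.
    by rewrite (le_trans (g0 _ _))// mul0r.
  by rewrite !Rintegral_probability_cst subrr normr0 mul0e.
rewrite -lee_pdivrMl//; apply: le_ereal_inf_tmp => _ [P Pc <-].
rewrite lee_pdivrMl//.
have bfst : bounded_measurable (fun p : borel T * borel T => g p.1).
  by case: bg => mg [M hM]; split; [exact: measurableT_comp|exists M].
have bsnd : bounded_measurable (fun p : borel T * borel T => g p.2).
  by case: bg => mg [M hM]; split; [exact: measurableT_comp|exists M].
have ifst := bounded_measurable_integrable P bfst.
have isnd := bounded_measurable_integrable P bsnd.
have -> : \int[eta]_y g y = \int[P]_p g p.1.
  rewrite /Rintegral; congr fine.
  rewrite -[RHS](@integral_pushforward _ _ _ _ _ fst _ P setT (EFin \o g))//.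
  - apply: eq_measure_integral => A mA _.
    apply: etrans (esym (Pc A mA).1) _.
    by congr (P _); apply/seteqP; split=> [[? ?] []|[? ?]].
  - by apply/measurable_EFinP; case: bg.
have -> : \int[eta']_y g y = \int[P]_p g p.2.
  rewrite /Rintegral; congr fine.
  rewrite -[RHS](@integral_pushforward _ _ _ _ _ snd _ P setT (EFin \o g))//.
  - apply: eq_measure_integral => A mA _.
    apply: etrans (esym (Pc A mA).2) _.
    by congr (P _); apply/seteqP; split=> [[? ?] []|[? ?]].
  - by apply/measurable_EFinP; case: bg.
rewrite -RintegralB// EFin_normr_Rintegral//; last first.
  by have := integrableB measurableT ifst isnd.
have mfs : measurable_fun setT (fun p : borel T * borel T => g p.1 - g p.2).
  by apply: measurable_funB; [case: bfst|case: bsnd].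
apply: le_trans (le_abse_integral _ _ _) _ => //; first exact/measurable_EFinP.
(* The factor goes into the left integrand, which is measurable; [rho] is not known to be. *)
rewrite -lee_pdivrMl// -ge0_integralZl_EFin//; last 2 first.
- by apply: measurableT_comp => //; exact/measurable_EFinP.
- by rewrite invr_ge0 ltW.
apply: ge0_le_lower_integral => p.
  by rewrite mule_ge0// lee_fin invr_ge0 ltW.
by rewrite -EFinM lee_fin ler_pdivrMl.
Qed.

(** * Resampling one coordinate *)

Section ProductSpace.
Variables (I : Type) (X : I -> ptopologicalType).

Lemma measurable_coord i :
  measurable_fun setT (fun x : prod_space X => x i : borel (X i)).
Proof.
move=> _ A mA; rewrite setTI; apply: sub_sigma_algebra.
by exists i => //; exists A.
Qed.

Lemma measurable_fun_prod_space d (T : measurableType d) (g : T -> prod_space X) :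
  (forall i, measurable_fun setT (fun w => g w i : borel (X i))) ->
  measurable_fun setT g.
Proof.
move=> mg; apply: (@measurability _ _ _ _ setT g (cylinders X)) => //.
move=> _ [_ [i _ [A mA <-]] <-].
exact: (mg i measurableT A mA).
Qed.

End ProductSpace.

Section Resampling.
Variables (R : realType) (n : nat) (X : 'I_n -> ptopologicalType).
Implicit Types (i j : 'I_n) (x z : prod_space X).

Lemma restrP i x z : (forall j, j != i -> x j = z j) <->
  restr x = restr z :> (forall k : {j | j \in off i}, X (sval k)).
Proof.
split=> [xz|xz j ji].
  apply: functional_extensionality_dep => -[j ji]; apply: xz => /=.
  by have := ji; rewrite !inE.
have ji' : j \in off i by rewrite !inE.
exact: (f_equal (fun r => r (exist _ j ji')) xz).
Qed.

Lemma measurable_restr i : measurable_fun setT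
  (fun x : prod_space X =>
    restr x : prod_space (fun k : {j | j \in off i} => X (sval k))).
Proof. by apply: measurable_fun_prod_space => k; exact: measurable_coord. Qed.

Definition upd i x (y : X i) : prod_space X := dfwith x i y.

Lemma upd_in i x y : @upd i x y i = y.
Proof. exact: dfwithin. Qed.

Lemma upd_out i x y j : j != i -> @upd i x y j = x j.
Proof. by move=> ji; rewrite /upd dfwithout// eq_sym. Qed.

Lemma restr_upd i x y : restr (@upd i x y) = restr x
  :> (forall k : {j | j \in off i}, X (sval k)).
Proof. by apply/restrP => j; exact: upd_out. Qed.

Lemma measurable_upd i : measurable_fun setT
  (fun p : prod_space X * borel (X i) => @upd i p.1 p.2).
Proof.
apply: measurable_fun_prod_space => j; have [->|ji] := eqVneq j i.
  apply: (eq_measurable_fun snd); last exact: measurable_snd.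
  by move=> p _; rewrite upd_in.
apply: (eq_measurable_fun 
  (fun p : prod_space X * borel (X i) => p.1 j : borel (X j))).
  by move=> p _; rewrite upd_out.
exact: (measurableT_comp (@measurable_coord _ X j) measurable_fst).
Qed.

Lemma measurable_updr i x : measurable_fun setT (fun y : borel (X i) => upd x y).
Proof.
exact: (measurableT_comp (@measurable_upd i) (measurable_pair1 x)).
Qed.

Variable k : cond_laws R X.

Definition cond_law i x : set (borel (X i)) -> \bar R := k i (restr x).

HB.instance Definition _ i x := Measure.on (@cond_law i x).
HB.instance Definition _ i x :=
  Measure_isProbability.Build _ _ _ (@cond_law i x) (prob_kernel _).


(** The family [cond_law] is packed as a probability kernel on the whole product space, so that
    parametrised integrals against it are measurable. *)
Lemma measurable_cond_law_integral i (h : prod_space X * borel (X i) -> \bar R) :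
  (forall p, 0 <= h p)%E -> measurable_fun setT h ->
  measurable_fun setT (fun x => \int[cond_law x]_y h (x, y))%E.
Proof.
move=> h0 mh.
have mk A : measurable A -> measurable_fun setT (fun x => @cond_law i x A).
  move=> mA; exact: (measurableT_comp (measurable_kernel (k i) A mA)
    (@measurable_restr i)).
pose K x : {measure set borel (X i) -> \bar R} := @cond_law i x.
pose K1 : isKernel _ _ _ _ R K := isKernel.Build _ _ _ _ R K mk.
pose K2 : kernel _ _ _ := HB.pack K K1.
have K1' x : K2 x setT = 1%E by exact: prob_kernel.
pose K3 : R.-pker _ ~> _ := HB.pack K K1
  (Kernel_isProbability.Build _ _ _ _ R K2 K1').
exact: (measurable_fun_integral_finite_kernel h K3).
Qed.

(** Makes the redrawing of coordinate [i] a measurable map into the Giry space, as needed to compose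
    it with [mu]. *)
Lemma measurable_giry_upd i :
  measurable_fun setT (fun x => giry_map (@measurable_updr i x) (cond_law x)).
Proof.
apply: measurable_giry_codensity => // A mA.
pose h (p : prod_space X * borel (X i)) := (\1_A (upd p.1 p.2))%:E : \bar R.
have mh : measurable_fun setT h.
  apply/measurable_EFinP; apply: measurableT_comp => //.
  exact: measurable_upd.
apply: (eq_measurable_fun (fun x => \int[cond_law x]_y h (x, y)))%E.
  move=> x _; pose B : set (borel (X i)) := [set y | A (upd x y)].
  have mB : measurable B.
    by rewrite -[B]setTI; exact: (@measurable_updr i x).
  transitivity (\int[cond_law x]_y (\1_B y)%:E)%E; first by [].
  by rewrite integral_indic// setIT.
by apply: measurable_cond_law_integral => // p; rewrite lee_fin.
Qed.

(** The heat-bath (single-site Gibbs sampler) operator, defined at every point and not merely almost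
    everywhere. *)
Definition resample i (h : prod_space X -> R) x : R :=
  \int[cond_law x]_y h (@upd i x y).

Section Operator.
Variable i : 'I_n.
Implicit Types h : prod_space X -> R.

Lemma bounded_measurable_upd h x :
  bounded_measurable h -> bounded_measurable (fun y : borel (X i) => h (upd x y)).
Proof.
move=> [mh [M hM]]; split; last by exists M.
exact: (measurableT_comp mh (@measurable_updr i x)).
Qed.

Lemma resample_affine h (a b : R) x : bounded_measurable h ->
  resample i (fun z => a + b * h z) x = a + b * resample i h x.
Proof. by move=> bh; apply: Rintegral_affine; exact: bounded_measurable_upd. Qed.

Lemma le_resample h h' x : bounded_measurable h -> bounded_measurable h' ->
  (forall y, h (@upd i x y) <= h' (upd x y)) -> resample i h x <= resample i h' x.
Proof.
move=> bh bh' hh'; apply: le_Rintegral => //.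
- exact: (bounded_measurable_integrable _ (bounded_measurable_upd x bh)).
- exact: (bounded_measurable_integrable _ (bounded_measurable_upd x bh')).
Qed.

Lemma resample_cst (c : R) x : resample i (fun=> c) x = c.
Proof. exact: Rintegral_probability_cst. Qed.

(** Reduces measurability and integral identities to nonnegative integrands; the factor [1] matches
    the shape of [resample_affine]. *)
Let shift h : bounded_measurable h -> exists h' c,
  [/\ bounded_measurable h', forall x, 0 <= h' x & h = fun x => c + 1 * h' x].
Proof.
move=> bh; have [M hM] := bh.2.
exists (fun x => M + 1 * h x), (- M); split.
- exact: bounded_measurable_affine.
- by move=> x; rewrite mul1r -lerBlDl sub0r; case/ler_normlP: (hM x); lra.
- by apply/funext => x; ring.
Qed.

Lemma resample_bounded_measurable h :
  bounded_measurable h -> bounded_measurable (resample i h).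
Proof.
move=> bh; split; last first.
  have [M hM] := bh.2; exists M => x; rewrite ler_norml; apply/andP; split.
    rewrite -[leLHS](resample_cst _ x); apply: le_resample => //.
      exact: bounded_measurable_cst.
    by move=> y; have /ler_normlP[] := hM (upd x y); lra.
  rewrite -[leRHS](resample_cst _ x); apply: le_resample => //.
    exact: bounded_measurable_cst.
  by move=> y; have /ler_normlP[] := hM (upd x y); lra.
have [h' [c [bh' h'0 ->]]] := shift bh.
rewrite (_ : resample i _ = fun x => c + 1 * resample i h' x); last first.
  by apply/funext => x; exact: resample_affine.
apply: measurable_funD => //; apply: measurable_funM => //.
apply/measurable_EFinP.
apply: (eq_measurable_fun (fun x => \int[cond_law x]_y (h' (@upd i x y))%:E)%E).
  by move=> x _; rewrite /= Rintegral_fineK//; exact: bounded_measurable_upd.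
apply: (@measurable_cond_law_integral i (fun p => (h' (upd p.1 p.2))%:E)).
  by move=> p; rewrite lee_fin.
by apply/measurable_EFinP; exact: (measurableT_comp bh'.1 (@measurable_upd i)).
Qed.

(** * Invariance of [mu] under resampling *)

Variable mu : probability (prod_space X) R.
Hypothesis hk : is_cond_law mu (k i).

Let nu : giry (prod_space X) R := giry_bind mu (@measurable_giry_upd i).

Let nuE (h : prod_space X -> \bar R) :
  measurable_fun setT h -> (forall x, 0 <= h x)%E ->
  (\int[nu]_x h x = \int[mu]_x \int[cond_law x]_y h (@upd i x y))%E.
Proof.
move=> mh h0; rewrite -[LHS]/(giry_int nu h) giry_int_bind//.
apply: eq_integral => x _.
by rewrite giry_int_map.
Qed.

(** The pi-system on which [is_cond_law] prescribes [mu]. *)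
Let rectangles := [set C : set (prod_space X) |
  exists (A : set (borel (X i)))
    (B : set (prod_space (fun l : {j | j \in off i} => X (sval l)))),
  [/\ measurable A, measurable B & C = [set x | A (x i) /\ B (restr x)]]].

Let rectangles_measurable C : rectangles C -> measurable C.
Proof.
move=> [A [B [mA mB ->]]]; apply: measurableI.
  by rewrite -[X in measurable X]setTI; exact: (@measurable_coord _ X i).
by rewrite -[X in measurable X]setTI; exact: (@measurable_restr i).
Qed.

Let measurable_rectanglesE : measurable = <<s rectangles >>.
Proof.
apply/seteqP; split; last first.
  apply: smallest_sub; first exact: sigma_algebra_measurable.
  exact: rectangles_measurable.
apply: smallest_sub; first exact: smallest_sigma_algebra.
move=> _ [j _ [A mA <-]]; apply: sub_sigma_algebra.
have [ji|ji] := eqVneq j i.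
  subst j; exists A, setT; split=> //.
  by apply/seteqP; split=> x // [].
have ji' : j \in off i by rewrite !inE.
exists setT, [set w : prod_space (fun l : {j | j \in off i} => X (sval l)) |
  A (w (exist _ j ji'))]; split=> //.
  rewrite -[X in measurable X]setTI.
  exact: (@measurable_coord _ (fun l : {j | j \in off i} => X (sval l))
    (exist _ j ji') measurableT A mA).
by apply/seteqP; split=> x // [].
Qed.

(** By uniqueness on a generating pi-system it suffices to treat rectangles. There, redrawing
    coordinate [i] does not affect membership in [B], so the [nu]-mass is the integral given by
    [is_cond_law]. *)
Let mu_nu A : measurable A -> mu A = nu A.
Proof.
apply: (measure_unique rectangles (fun=> setT)) => //.
- move=> _ _ [A1 [B1 [mA1 mB1 ->]]] [A2 [B2 [mA2 mB2 ->]]].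
  exists (A1 `&` A2), (B1 `&` B2); split; [exact: measurableI..|].
  by apply/seteqP; split=> x /= [[? ?] [? ?]].
- by move=> _; exists setT, setT; split=> //; apply/seteqP; split.
- by rewrite bigcup_const.
- move=> C rC; have mC := rectangles_measurable rC.
  have [A1 [B [mA1 mB CE]]] := rC.
  transitivity (mu [set x | A1 (x i) /\ B (restr x)]); first by rewrite CE.
  apply: etrans (hk mA1 mB) _.
  rewrite integral_mkcond -(setIT C) -integral_indic// nuE//; last first.
    exact/measurable_EFinP/measurable_indic.
  apply: eq_integral => x _.
  have CxyE y : C (@upd i x y) <-> A1 y /\ B (restr x).
    by rewrite CE /= upd_in restr_upd.
  rewrite patchE; case: ifPn => [/set_mem/= Bx|/negP Bx].
    transitivity (\int[cond_law x]_y (\1_A1 y)%:E)%E.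
      by rewrite integral_indic// setIT.
    apply: eq_integral => y _; rewrite !indicE.
    suff -> : (@upd i x y \in C) = (y \in A1) by [].
    apply/idP/idP => /set_mem yC; apply/mem_set; last exact/CxyE.
    by case/CxyE: yC.
  rewrite integral0_eq// => y _; rewrite indicE memNset// => /CxyE[_ Bx'].
  by apply: Bx; exact/mem_set.
- by move=> _; rewrite -ge0_fin_numE// fin_num_measure.
Qed.

Lemma Rintegral_resample h : bounded_measurable h ->
  \int[mu]_x resample i h x = \int[mu]_x h x.
Proof.
move=> bh; have [h' [c [bh' h'0 ->]]] := shift bh.
rewrite (_ : resample i _ = fun x => c + 1 * resample i h' x); last first.
  by apply/funext => x; exact: resample_affine.
rewrite !Rintegral_affine//; last exact: resample_bounded_measurable.
congr (_ + _ * _); rewrite /Rintegral; congr fine.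
transitivity (\int[nu]_x (h' x)%:E)%E; last first.
  by apply: eq_measure_integral => A mA _; apply: esym; exact: mu_nu.
rewrite nuE; last 2 first.
- by apply/measurable_EFinP; case: bh'.
- by move=> x; rewrite lee_fin.
by apply: eq_integral => x _; rewrite Rintegral_fineK//; exact: bounded_measurable_upd.
Qed.

End Operator.


End Resampling.

(** * Oscillations *)

Section Oscillation.
Variables (R : realType) (n : nat) (X : 'I_n -> ptopologicalType).
Variable rho : forall i, X i -> X i -> R.
Hypothesis rho_metric : forall i, is_metric (@rho i).
Implicit Types (i j : 'I_n) (x z : prod_space X) (a : 'rV[R]_n)
  (h : prod_space X -> R).

(** The entries of [a] are upper bounds, which are easier to track through resampling than exact
    oscillations. *)
Definition osc_le h a := forall i x z, (forall j, j != i -> x j = z j) ->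
  `|h x - h z| <= a 0 i * rho (x i) (z i).

Let rho_ge0 i (y z : X i) : 0 <= @rho i y z.
Proof. by case: (rho_metric i). Qed.

Let rho_xx i (y : X i) : @rho i y y = 0.
Proof. by case: (rho_metric i) => _ /(_ y y)[_ ->]. Qed.

Lemma prod_space_eq i x z : (forall j, j != i -> x j = z j) ->
  rho (x i) (z i) = 0 -> x = z.
Proof.
move=> xz; have [_ /(_ (x i) (z i))[+ _] _ _] := rho_metric i.
move=> /[apply] xzi.
apply: functional_extensionality_dep => j.
by have [->//|/xz] := eqVneq j i.
Qed.

Lemma osc_le_dist h a x z : osc_le h a ->
  `|h x - h z| <= \sum_i a 0 i * rho (x i) (z i).
Proof.
move=> ha.
(* Replace the coordinates of [x] by those of [z] one at a time. *)
pose hyb m : prod_space X := fun j => if (j < m)%N then z j else x j.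
have hyb0 : hyb 0%N = x by [].
have hybn : hyb n = z.
  by apply: functional_extensionality_dep => j; rewrite /hyb ltn_ord.
suff H m : (m <= n)%N ->
    `|h x - h (hyb m)| <= \sum_(i < n | (i < m)%N) a 0 i * rho (x i) (z i).
  have := H n (leqnn n); rewrite hybn => /le_trans; apply.
  by under eq_bigl do rewrite ltn_ord.
elim: m => [_|m ih mn]; first by rewrite hyb0 subrr normr0 big_pred0.
pose i := Ordinal mn.
rewrite (bigD1 i)//= addrC.
have -> : h x - h (hyb m.+1) =
    (h x - h (hyb m)) + (h (hyb m) - h (hyb m.+1)) by ring.
apply: le_trans (ler_normD _ _) _; apply: lerD.
  apply: le_trans (ih (ltnW mn)) _; rewrite le_eqVlt; apply/orP; left.
  apply/eqP/eq_bigl => j; rewrite ltnS [in RHS]leq_eqVlt -val_eqE /=.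
  by case: eqP => [->|]; rewrite ?ltnn ?andbT.
have hm : hyb m i = x i by rewrite /hyb /= ltnn.
have hm1 : hyb m.+1 i = z i by rewrite /hyb /= ltnSn.
rewrite -hm -hm1; apply: ha => j.
by rewrite -val_eqE /= /hyb ltnS [in RHS]leq_eqVlt => /negPf ->.
Qed.

Variable k : cond_laws R X.
Hypothesis coef_fin : forall i j, (dobrushin_coef rho k i j < +oo)%E.

Let C := dobrushin_mx rho k.

Lemma dobrushin_coef_ge0 i j : (0 <= dobrushin_coef rho k i j)%E.
Proof.
(* The diagonal pair contributes [0], because [0^-1 = 0]. *)
apply: ereal_sup_ubound; exists (point, point) => //=.
by rewrite rho_xx invr0 mule0.
Qed.

Lemma dobrushin_mx_ge0 i j : 0 <= C i j.
Proof. by rewrite mxE fine_ge0// dobrushin_coef_ge0. Qed.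

Lemma wasserstein1_le_dobrushin_mx i j x z : (forall l, l != j -> x l = z l) ->
  0 < rho (x j) (z j) ->
  (wasserstein1 (@rho i) (cond_law k (i := i) x) (cond_law k (i := i) z)
    <= (C i j * rho (x j) (z j))%:E)%E.
Proof.
move=> xz rxz; rewrite EFinM -lee_pdivrMr// mxE fineK; last first.
  by rewrite ge0_fin_numE ?dobrushin_coef_ge0.
by apply: ereal_sup_ubound; exists (x, z) => //=; apply/restrP.
Qed.

(** The oscillation at [i] is removed and redistributed along the [i]-th row of [C]. *)
Definition resample_osc i a : 'rV[R]_n := a + a 0 i *: (row i C - delta_mx 0 i).

Lemma resample_osc_ge0 i a : (forall j, 0 <= a 0 j) ->
  forall j, 0 <= resample_osc i a 0 j.
Proof.
move=> a0 j; rewrite !mxE eqxx /= -/(C i j).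
have := mulr_ge0 (a0 i) (dobrushin_mx_ge0 i j); have := a0 j.
by have [->|_] := eqVneq j i; rewrite !mxE /=; lra.
Qed.

(** Moving coordinate [j != i] changes the integrand, at cost [a 0 j], and the conditional law of
    coordinate [i], at cost [a 0 i * C i j] by Kantorovich duality. For [j = i] nothing changes,
    since coordinate [i] is averaged out. *)
Lemma osc_le_resample i h a : bounded_measurable h -> (forall j, 0 <= a 0 j) ->
  osc_le h a -> osc_le (resample k i h) (resample_osc i a).
Proof.
move=> bh a0 ha j x z xz.
have osc0 : 0 <= resample_osc i a 0 j * rho (x j) (z j).
  by rewrite mulr_ge0// resample_osc_ge0.
have [ji|ji] := eqVneq j i.
  subst j; suff -> : resample k i h x = resample k i h z.
    by rewrite subrr normr0.
  have updE : @upd _ _ i x = @upd _ _ i z.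
    apply/funext => y; apply: functional_extensionality_dep => l.
    by have [->|li] := eqVneq l i; [rewrite !upd_in|rewrite !upd_out// xz].
  have restrE : restr x = restr z
    :> (forall l : {j | j \in off i}, X (sval l)) by apply/restrP.
  rewrite /resample updE; congr fine.
  apply: eq_measure_integral => A mA _.
  exact: (congr1 (fun r => k i r A) restrE).
(* At zero distance the Dobrushin quotient carries no information, but then [x = z]. *)
have [rxz|rxz] := eqVneq (rho (x j) (z j)) 0.
  by rewrite (prod_space_eq xz rxz) subrr normr0 mulr_ge0// resample_osc_ge0.
have {}rxz : 0 < rho (x j) (z j) by rewrite lt_def rxz rho_ge0.
pose P x := @cond_law _ _ _ k i x.
pose hz (y : borel (X i)) := h (upd z y).
have bhx : bounded_measurable (fun y : borel (X i) => h (upd x y)).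
  exact: bounded_measurable_upd.
have bhz : bounded_measurable hz by exact: bounded_measurable_upd.
have hxz : `|resample k i h x - \int[P x]_y hz y| <= a 0 j * rho (x j) (z j).
  apply: Rintegral_dist_le => // y.
  have := ha j (upd x y) (upd z y); rewrite !upd_out//; apply => l lj.
  by have [->|li] := eqVneq l i; rewrite ?upd_in// !upd_out// xz.
have hW : `|\int[P x]_y hz y - \int[P z]_y hz y| <=
    a 0 i * (C i j * rho (x j) (z j)).
  rewrite -lee_fin.
  apply: le_trans (wasserstein1_dual _ _ _ bhz (a0 i) _) _ => //.
    move=> y y'; have := ha i (upd z y) (upd z y'); rewrite !upd_in; apply.
    by move=> l li; rewrite !upd_out.
  by rewrite EFinM lee_wpmul2l// ?lee_fin//; exact: wasserstein1_le_dobrushin_mx.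
have -> : resample k i h x - resample k i h z =
  (resample k i h x - \int[P x]_y hz y) +
  (\int[P x]_y hz y - \int[P z]_y hz y) by rewrite /resample; ring.
rewrite (le_trans (ler_normD _ _))// !mxE (negbTE ji) /= subr0 mulrDl lerD//.
by move: hW; rewrite [C i j]mxE mulrA.
Qed.

(** * Averaging operators *)

Variable mu : probability (prod_space X) R.
Hypothesis hk : forall i, is_cond_law mu (k i).

Definition agree (m : nat) x z := forall i, (i < m)%N -> x i = z i.

(* The properties shared by all composites of resampling operators at
   coordinates [i >= m]. *)
Record averaging (m : nat) (S : (prod_space X -> R) -> prod_space X -> R) :
    Prop := Averaging {
  avg_bounded_measurable : forall h,
    bounded_measurable h -> bounded_measurable (S h);
  avg_Rintegral : forall h,
    bounded_measurable h -> \int[mu]_x S h x = \int[mu]_x h x;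
  avg_affine : forall h (b c : R) x,
    bounded_measurable h -> S (fun z => b + c * h z) x = b + c * S h x;
  avg_le : forall h h' x, bounded_measurable h -> bounded_measurable h' ->
    (forall z, agree m x z -> h z <= h' z) -> S h x <= S h' x }.

Lemma averaging_id m : averaging m id.
Proof. by split=> // h h' x _ _; apply. Qed.

Lemma averaging_resample m i : (m <= i)%N -> averaging m (resample k i).
Proof.
move=> mi; split.
- exact: resample_bounded_measurable.
- by move=> h; exact: Rintegral_resample.
- by move=> h b c x; exact: resample_affine.
- move=> h h' x bh bh' hh'; apply: le_resample => // y; apply: hh' => j jm.
  by rewrite upd_out// -val_eqE /= ltn_eqF// (leq_trans jm).
Qed.

Lemma averaging_comp m S S' :
  averaging m S -> averaging m S' -> averaging m (S \o S').
Proof.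
move=> aS aS'; split=> /=.
- by move=> h bh; exact/(avg_bounded_measurable aS)/(avg_bounded_measurable aS').
- move=> h bh; rewrite (avg_Rintegral aS) ?(avg_Rintegral aS')//.
  exact: (avg_bounded_measurable aS').
- move=> h b c x bh.
  rewrite -(avg_affine aS)//; last exact: (avg_bounded_measurable aS').
  by congr (S _ x); apply/funext => z; exact: (avg_affine aS').
- move=> h h' x bh bh' hh'.
  apply: (avg_le aS); [exact: (avg_bounded_measurable aS')..|] => z xz.
  apply: (avg_le aS') => // w zw; apply: hh' => i im.
  by rewrite xz// zw.
Qed.

Lemma averaging_cst m S (c : R) x : averaging m S -> S (fun=> c) x = c.
Proof.
move=> aS; transitivity (S (fun=> c + 0 * 0) x); first by rewrite mul0r addr0.
rewrite (avg_affine aS c 0 x (bounded_measurable_cst _ 0)).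
by rewrite mul0r addr0.
Qed.

(** On the configurations agreeing with [x] below [m], [h] takes values in an interval of length
    [c]. The exponential lies there below an affine function of [h], and [S] is monotone and
    commutes with affine maps. *)
Lemma averaging_expR m S h (c l : R) x : averaging m S -> bounded_measurable h ->
  (forall y z, agree m x y -> agree m x z -> h y - h z <= c) ->
  S (fun z => expR (l * h z)) x <= expR (l * S h x + l ^+ 2 * c ^+ 2 / 8).
Proof.
move=> aS bh hc.
pose V := [set h z | z in [set z | agree m x z]].
have Vx : V (h x) by exists x.
have Vlb : has_lbound V.
  by exists (h x - c) => _ [z xz <-]; have := hc x z (fun _ _ => erefl) xz; lra.
pose lo := inf V.
have lo_le z : agree m x z -> lo <= h z <= lo + c.
  move=> xz; apply/andP; split; first by apply: ge_inf => //; exists z.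
  rewrite -lerBlDr; apply: lb_le_inf; first by exists (h x).
  by move=> _ [y xy <-]; have := hc z y xz xy; lra.
have bc r := bounded_measurable_cst (prod_space X) (r : R).
have Sx : lo <= S h x <= lo + c.
  apply/andP; split.
    rewrite -[leLHS](averaging_cst _ x aS); apply: (avg_le aS) => // z.
    by case/lo_le/andP.
  rewrite -[leRHS](averaging_cst _ x aS); apply: (avg_le aS) => // z.
  by case/lo_le/andP.
have [|al [be [chord bound]]] := @expR_affine_majorant _ l lo (lo + c) (S h x) c Sx.
  by lra.
apply: le_trans bound; rewrite -(avg_affine aS)//; apply: (avg_le aS).
- exact: bounded_measurable_expR.
- exact: bounded_measurable_affine.
- by move=> z /lo_le; exact: chord.
Qed.

(** * Smoothing by repeated resampling *)

Let D := neumann_mx C.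
Hypothesis C1 : spectral_radius C < 1.

(** Since [C *m D = D - 1], the row [row i C - e_i] times [D] is [- e_i]. *)
Lemma resample_osc_neumann i a j :
  (resample_osc i a *m D) 0 j = (a *m D) 0 j - a 0 i *+ (j == i).
Proof.
have CD : C *m D = D - 1%:M.
  by rewrite {2}/D (neumann_mx_fixpoint dobrushin_mx_ge0 C1) -/D addrAC subrr add0r.
rewrite /resample_osc mulmxDl -scalemxAl mulmxBl -row_mul CD -rowE.
rewrite !mxE; congr (_ + _).
rewrite [in RHS]eq_sym; case: eqP => _ /=; rewrite ?mulr1n ?mulr0n; ring.
Qed.

Lemma le_row_mul_neumann a j : (forall i, 0 <= a 0 i) -> a 0 j <= (a *m D) 0 j.
Proof.
move=> a0; rewrite /D (neumann_mx_fixpoint dobrushin_mx_ge0 C1) -/D mulmxDr.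
rewrite mulmx1 mxE lerDl mxE sumr_ge0// => i _; rewrite mulr_ge0// mxE.
rewrite sumr_ge0// => l _; rewrite mulr_ge0 ?dobrushin_mx_ge0//.
exact: (neumann_mx_ge0 dobrushin_mx_ge0 C1).
Qed.

(* Resampling a coordinate whose oscillation exceeds [eps] lowers the
   potential [\sum_j (a *m D) 0 j] by at least [eps]. *)
Lemma averaging_smoothing m (eps : R) h a : 0 < eps ->
  bounded_measurable h -> (forall i, 0 <= a 0 i) -> osc_le h a ->
  exists S a', [/\ averaging m S, osc_le (S h) a', forall i, 0 <= a' 0 i,
    forall i, (a' *m D) 0 i <= (a *m D) 0 i &
    forall i : 'I_n, (m <= i)%N -> a' 0 i <= eps].
Proof.
move=> eps0.
(* [N] bounds the number of resamplings, each of which uses up at least [eps] of the potential. *)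
have [N hN] : exists N, \sum_j (a *m D) 0 j <= eps *+ N.
  set s := \sum_j _; exists (Num.bound (`|s| / eps)).
  rewrite -mulr_natr mulrC -ler_pdivrMr// ltW//.
  apply: le_lt_trans (archi_boundP _); last by rewrite divr_ge0// ltW.
  by rewrite ler_wpM2r ?ler_norm// invr_ge0 ltW.
have le_potential (b : 'rV[R]_n) j : (forall i, 0 <= b 0 i) ->
    b 0 j <= \sum_l (b *m D) 0 l.
  move=> b0; rewrite (bigD1 j)//= -[leLHS]addr0 lerD ?le_row_mul_neumann//.
  by apply: sumr_ge0 => l _; exact: le_trans (b0 l) (le_row_mul_neumann l b0).
elim: N h a hN => [|N ih] h a hN bh a0 ha.
  (* With no potential left, every entry of [a] is at most [0], hence at most [eps]. *)
  exists id, a; split=> // [|i _]; first exact: averaging_id.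
  by rewrite (le_trans (le_potential a i a0))// (le_trans hN)// mulr0n ltW.
have [all_le|] := pselect (forall i : 'I_n, (m <= i)%N -> a 0 i <= eps).
  by exists id, a; split=> //; exact: averaging_id.
move=> /existsNP[i /not_implyP[mi /negP]]; rewrite -ltNge => ai.
have a0' := resample_osc_ge0 i a0.
have [|||S [a' [aS ha' a'0 a'D a'eps]]] :=
  ih (resample k i h) (resample_osc i a) _ _ a0'.
- under eq_bigr do rewrite resample_osc_neumann.
  rewrite sumrB (_ : \sum_j a 0 i *+ (j == i) = a 0 i).
    by move: hN; rewrite mulrSr; lra.
  by rewrite (bigD1 i)//= eqxx big1 ?addr0// => j /negPf ->.
- exact: resample_bounded_measurable.
- exact: osc_le_resample.
exists (S \o resample k i), a'; split=> //.
  by apply: averaging_comp => //; exact: averaging_resample.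
move=> j; apply: le_trans (a'D j) _; rewrite resample_osc_neumann lerBlDr lerDl.
by rewrite mulrn_wge0.
Qed.

(** * Bounds on the Laplace transform *)

Variable r : 'I_n -> R.
Hypothesis rho_le : forall i (y z : X i), rho y z <= r i.

Let r_ge0 i : 0 <= r i.
Proof. exact: le_trans (rho_ge0 point point) (rho_le (i := i) point point). Qed.

Lemma osc_le_agree h a m x z : osc_le h a -> (forall i, 0 <= a 0 i) ->
  agree m x z -> `|h x - h z| <= \sum_(i < n | (m <= i)%N) a 0 i * r i.
Proof.
move=> ha a0 xz; apply: le_trans (osc_le_dist x z ha) _.
rewrite (bigID (fun i : 'I_n => (m <= i)%N))/= [X in _ + X]big1 ?addr0.
  by apply: ler_sum => i _; rewrite ler_wpM2l.
by move=> i; rewrite -ltnNge => im; rewrite xz// rho_xx mulr0.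
Qed.

(** Induction on [p = n - m]. Passing from [m.+1] to [m] smooths [g] at the coordinates from [m] on
    and costs one Hoeffding factor. *)
Lemma mgf_descent f a (eps : R) : bounded_measurable f ->
  (forall i, 0 <= a 0 i) -> osc_le f a -> 0 < eps ->
  forall p m, (m + p)%N = n -> exists g b,
  [/\ bounded_measurable g, osc_le g b, forall i, 0 <= b 0 i &
    forall i, (b *m D) 0 i <= (a *m D) 0 i] /\
  [/\ forall i : 'I_n, (m <= i)%N -> b 0 i <= eps,
    \int[mu]_x g x = \int[mu]_x f x &
    forall l, \int[mu]_x expR (l * f x) <=
      expR (l ^+ 2 / 8 * \sum_(i < n | (m <= i)%N)
        (r i * (a *m D) 0 i + eps * \sum_j r j) ^+ 2) *
      \int[mu]_x expR (l * g x)].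
Proof.
move=> bf a0 fa eps0; elim=> [|p ih] m.
  rewrite addn0 => ->; exists f, a; split; split=> //.
    by move=> i; rewrite leqNgt ltn_ord.
  move=> l; rewrite big_pred0 ?mulr0 ?expR0 ?mul1r// => i.
  by rewrite leqNgt ltn_ord.
rewrite addnS -addSn => /[dup] mpn /ih[g [b [[bg gb b0 bD] [beps gf fg]]]].
have [S [b' [aS gb' b'0 b'D b'eps]]] := averaging_smoothing m eps0 bg b0 gb.
have bSg : bounded_measurable (S g) by exact: (avg_bounded_measurable aS).
exists (S g), b'; split; split=> //.
- by move=> i; exact: le_trans (b'D i) (bD i).
- by rewrite (avg_Rintegral aS).
move=> l; apply: le_trans (fg l) _.
have mn : (m < n)%N by rewrite -mpn addSn ltnS leq_addr.
pose i := Ordinal mn.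
have sumE (F : 'I_n -> R) :
    \sum_(j < n | (m <= j)%N) F j = \sum_(j < n | (m < j)%N) F j + F i.
  rewrite (bigD1 i)//= addrC; congr (_ + _); apply: eq_bigl => j.
  by rewrite -val_eqE /= ltn_neqAle eq_sym andbC.
rewrite sumE mulrDr expRD -[leRHS]mulrA.
rewrite ler_wpM2l ?expR_ge0//.
set c := r i * _ + _.
(* Coordinate [m] contributes at most [r i * (a *m D) 0 i]; the later ones have oscillation at most
   [eps] by induction. *)
have gc y z x : agree m x y -> agree m x z -> g y - g z <= c.
  move=> xy xz; apply: le_trans (ler_norm _) _.
  apply: le_trans (osc_le_agree gb b0 (_ : agree m y z)) _.
    by move=> j jm; rewrite -xy// xz.
  rewrite sumE addrC lerD//.
    rewrite mulrC ler_wpM2l// (le_trans _ (bD i))//.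
    exact: le_row_mul_neumann.
  rewrite mulr_sumr [leRHS](bigID (fun j : 'I_n => (m < j)%N))/=.
  rewrite -[leLHS]addr0 lerD//; last first.
    by apply: sumr_ge0 => j _; rewrite mulr_ge0// ltW.
  by apply: ler_sum => j mj; rewrite ler_wpM2r// beps.
(* As [S] preserves integrals, it can be inserted before applying the pointwise Hoeffding bound. *)
rewrite -(avg_Rintegral aS (bounded_measurable_expR l bg)).
have be := bounded_measurable_expR l bSg.
rewrite -[leRHS]add0r -(Rintegral_affine mu 0 _ be).
apply: le_Rintegral => //.
- apply: bounded_measurable_integrable; apply: (avg_bounded_measurable aS).
  exact: bounded_measurable_expR.
- exact: (bounded_measurable_integrable mu (bounded_measurable_affine 0 _ be)).
move=> x _; rewrite add0r -expRD [leRHS](_ : _ =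
  expR (l * S g x + l ^+ 2 * c ^+ 2 / 8)); last by congr expR; ring.
by apply: (averaging_expR l aS bg) => y z; exact: gc.
Qed.

(** At [m = 0] the smoothed function is within [eps * K] of its mean, which is that of [f]; then
    [eps] tends to [0]. *)
Lemma mgf_bound f a : bounded_measurable f -> (forall i, 0 <= a 0 i) ->
  osc_le f a -> forall l, \int[mu]_x expR (l * f x) <=
  expR (l * \int[mu]_x f x + l ^+ 2 * (\sum_i (r i * (a *m D) 0 i) ^+ 2) / 8).
Proof.
move=> bf a0 fa l.
pose c i := r i * (a *m D) 0 i; pose K := \sum_j r j.
have c0 i : 0 <= c i.
  by rewrite mulr_ge0// (le_trans (a0 i))// le_row_mul_neumann.
have K0 : 0 <= K by exact: sumr_ge0.
have bound eps : 0 < eps -> \int[mu]_x expR (l * f x) <=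
    expR (l ^+ 2 / 8 * (\sum_i (c i + eps * K) ^+ 2) +
      (l * \int[mu]_x f x + `|l| * (eps * K))).
  move=> eps0.
  have [g [b [[bg gb b0 bD] [beps gf fg]]]] :=
    mgf_descent bf a0 fa eps0 (add0n n).
  apply: le_trans (fg l) _; rewrite expRD ler_wpM2l ?expR_ge0//.
  have gg x z : `|g x - g z| <= eps * K.
    apply: le_trans (osc_le_agree gb b0 (_ : agree 0 x z)) _ => //.
    by rewrite mulr_sumr; apply: ler_sum => i _; rewrite ler_wpM2r// beps.
  have gE x : `|g x - \int[mu]_x f x| <= eps * K.
    rewrite -gf -[X in `|X - _|](Rintegral_probability_cst mu).
    exact: (Rintegral_dist_le mu (bounded_measurable_cst _ _) bg).
  rewrite -[leRHS](Rintegral_probability_cst mu); apply: le_Rintegral => //.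
  - exact: (bounded_measurable_integrable mu (bounded_measurable_expR l bg)).
  - exact: (bounded_measurable_integrable mu (bounded_measurable_cst _ _)).
  move=> x _; rewrite ler_expR -lerBlDl -mulrBr (le_trans (ler_norm _))//.
  by rewrite normrM ler_wpM2l.
have [I0|I0] := leP (\int[mu]_x expR (l * f x)) 0.
  exact: le_trans I0 (expR_ge0 _).
rewrite -ler_ln ?posrE ?expR_gt0// expRK.
(* For [eps <= 1] we have [eps ^+ 2 <= eps], so the error is at most linear in [eps]. *)
have {}bound eps : 0 < eps <= 1 -> ln (\int[mu]_x expR (l * f x)) <=
    l * \int[mu]_x f x + l ^+ 2 * (\sum_i c i ^+ 2) / 8 +
    eps * (l ^+ 2 / 8 * (\sum_i (2 * c i * K + K ^+ 2)) + `|l| * K).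
  move=> /andP[eps0 eps1].
  rewrite -[leRHS]expRK ler_ln ?posrE ?expR_gt0//.
  apply: le_trans (bound _ eps0) _; rewrite ler_expR.
  have sqE i : (c i + eps * K) ^+ 2 <=
      c i ^+ 2 + eps * (2 * c i * K + K ^+ 2).
    have : 0 <= eps * (1 - eps) * K ^+ 2.
      by rewrite !mulr_ge0 ?sqr_ge0 ?subr_ge0// ltW.
    by nra.
  have sumE : \sum_i (c i + eps * K) ^+ 2 <=
      \sum_i c i ^+ 2 + eps * \sum_i (2 * c i * K + K ^+ 2).
    apply: (@le_trans _ _ (\sum_i (c i ^+ 2 + eps * (2 * c i * K + K ^+ 2)))).
      by apply: ler_sum => i _; exact: sqE.
    by rewrite big_split/= -mulr_sumr.
  have l8 : 0 <= l ^+ 2 / 8 by rewrite divr_ge0// sqr_ge0.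
  have := ler_wpM2l l8 sumE; lra.
set q := l ^+ 2 / 8 * _ + _ in bound.
have q0 : 0 <= q.
  have cK0 : 0 <= \sum_i (2 * c i * K + K ^+ 2).
    apply: sumr_ge0 => i _; have cKi := mulr_ge0 (c0 i) K0.
    have := sqr_ge0 K; lra.
  apply: addr_ge0; apply: mulr_ge0 => //.
  by rewrite divr_ge0// sqr_ge0.
apply/ler_addgt0Pr => e e0.
(* Using [q + 1] instead of [q] keeps the denominator positive. *)
pose eps := Num.min 1 (e / (q + 1)).
have q1 : 0 < q + 1 by lra.
have eps01 : 0 < eps <= 1 by rewrite lt_min ltr01 divr_gt0//= ge_min lexx.
apply: le_trans (bound _ eps01) _; rewrite lerD2l.
apply: (@le_trans _ _ (e / (q + 1) * (q + 1))); last first.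
  by rewrite divfK// gt_eqF.
apply: ler_pM => //; [by case/andP: eps01 => /ltW| |by rewrite lerDl].
by rewrite ge_min lexx orbT.
Qed.

End Oscillation.

(** * Concentration *)

Section Tail.
Context d (T : measurableType d) (R : realType) (P : probability T R).
Implicit Types (h : T -> R).

(** Markov's inequality for [expR (l * h)], followed by optimisation over [l]. *)
Lemma chernoff_upper_tail h (V t : R) : bounded_measurable h -> 0 <= V -> 0 <= t ->
  (forall l, 0 <= l -> \int[P]_x expR (l * h x) <=
    expR (l * \int[P]_x h x + l ^+ 2 * V / 8)) ->
  (P [set x | (t <= h x - \int[P]_x h x)%R] <=
    expeR (- ((2 * t ^+ 2)%:E / V%:E)))%E.
Proof.
move=> bh V0 t0 mgf.
set m := \int[P]_x h x; set A := [set x | _].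
have mA : measurable A.
  have -> : A = setT `&` h @^-1` `[m + t, +oo[.
    apply/seteqP; split=> x /=; rewrite in_itv/= andbT -lerBrDl//.
    by case.
  by apply: bh.1.
have [pA PAE] : exists pA, P A = pA%:E.
  by exists (fine (P A)); rewrite fineK// fin_num_measure.
have pA1 : pA <= 1 by rewrite -lee_fin -PAE probability_le1.
have pA_le l : 0 <= l -> pA <= expR (l ^+ 2 * V / 8 - l * t).
  move=> l0.
  have be := bounded_measurable_expR l bh.
  have be' := bounded_measurable_affine 0 (expR (- (l * (m + t)))) be.
  apply: (@le_trans _ _ (\int[P]_x (0 + expR (- (l * (m + t))) * expR (l * h x)))).
    rewrite -lee_fin -PAE -Rintegral_fineK// -[in leLHS](setIT A) -integral_indic//.
    apply: ge0_le_lower_integral => x; rewrite lee_fin//.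
    rewrite indicE add0r -expRD; case: (asboolP (A x)) => Ax; last first.
      by rewrite memNset// expR_ge0.
    rewrite mem_set// -expR0 ler_expR addrC -mulrBr mulr_ge0//.
    by move: Ax; rewrite /A /=; lra.
  rewrite Rintegral_affine// add0r.
  apply: le_trans (ler_wpM2l (expR_ge0 _) (mgf l l0)) _.
  rewrite -expRD ler_expR -/m; lra.
(* For [t = 0] the bound is [1] even if [V = 0], as [0 * +oo = 0]. *)
rewrite PAE; have [->|tN0] := eqVneq t 0.
  by rewrite expr0n /= mulr0 mul0e oppe0 expeR0 lee_fin.
have {tN0}t0 : 0 < t by rewrite lt_def tN0.
have [V00|VN0] := eqVneq V 0.
  (* For [V = 0] the bound is [0]. If [pA > 0], this choice of [l] would give [pA <= pA / e]. *)
  rewrite V00 inve0 gt0_muley ?lte_fin ?mulr_gt0 ?exprn_gt0//= lee_fin.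
  rewrite leNgt; apply/negP => pA0.
  have l0 : 0 <= (1 - ln pA) / t.
    by rewrite divr_ge0 ?(ltW t0)// subr_ge0 (le_trans (ln_le0 pA1)).
  have := pA_le _ l0; rewrite V00 mulr0 mul0r sub0r divfK ?gt_eqF//.
  rewrite opprB -{1}[pA](lnK (x := pA)) ?posrE// ler_expR; lra.
have {VN0}V0 : 0 < V by rewrite lt_def VN0.
(* The minimiser of [l ^+ 2 * V / 8 - l * t], with minimum [- 2 * t ^+ 2 / V]. *)
have l0 : 0 <= 4 * t / V by rewrite divr_ge0// ?mulr_ge0// ltW.
rewrite inver gt_eqF//= lee_fin; apply: le_trans (pA_le _ l0) _.
rewrite ler_expR le_eqVlt; apply/orP; left; apply/eqP; field.
by rewrite gt_eqF.
Qed.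

(** The upper tail bound is applied to [h] and to [- h]; the latter uses the Laplace bound at
    [- l]. *)
Lemma chernoff_tail h (V t : R) : bounded_measurable h -> 0 <= V -> 0 <= t ->
  (forall l, \int[P]_x expR (l * h x) <=
    expR (l * \int[P]_x h x + l ^+ 2 * V / 8)) ->
  (P [set x | (t <= `|h x - \int[P]_x h x|)%R] <=
    2%:E * expeR (- ((2 * t ^+ 2)%:E / V%:E)))%E.
Proof.
move=> bh V0 t0 mgf.
have bNh : bounded_measurable (fun x => - h x).
  have := bounded_measurable_affine 0 (-1) bh.
  by congr (bounded_measurable _); apply/funext => x; ring.
have EN : \int[P]_x (- h x) = - (\int[P]_x h x).
  rewrite -[RHS]mulN1r -[RHS]add0r -Rintegral_affine//.
  by apply: eq_Rintegral => x _; ring.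
have up := chernoff_upper_tail bh V0 t0 (fun l _ => mgf l).
have mgfN l : \int[P]_x expR (l * - h x) <=
    expR (l * - (\int[P]_x h x) + l ^+ 2 * V / 8).
  have IE : \int[P]_x expR (l * - h x) = \int[P]_x expR (- l * h x).
    by apply: eq_Rintegral => x _; rewrite mulrN mulNr.
  by rewrite IE mulrN -mulNr -(sqrrN l); exact: mgf.
have := chernoff_upper_tail bNh V0 t0; rewrite EN => /(_ (fun l _ => mgfN l)) down.
pose A := [set x | t <= h x - \int[P]_x h x].
pose B := [set x | t <= - h x - - (\int[P]_x h x)].
have mA (c : R) h' : bounded_measurable h' -> measurable [set x | t <= h' x - c].
  move=> [mh' _]; have -> : [set x | t <= h' x - c] = setT `&` h' @^-1` `[c + t, +oo[.
    apply/seteqP; split=> x /=; rewrite in_itv/= andbT -lerBrDl//.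
    by case.
  by apply: mh'.
have -> : [set x | t <= `|h x - \int[P]_x h x|] = A `|` B.
  apply/seteqP; split=> x; rewrite /A /B /= ler_normr.
    by case/orP; [left|right; lra].
  by case=> [->//|h1]; apply/orP; right; lra.
rewrite mule_natl mule2n.
apply: (@le_trans _ _ (P A + P B)%E); last by rewrite leeD.
by apply: measureU2; exact: mA.
Qed.

End Tail.

(** * Oscillations of Lipschitz functions *)

Section LocalOscillation.
Variables (R : realType) (n : nat) (X : 'I_n -> ptopologicalType).
Variable rho : forall i, X i -> X i -> R.
Hypothesis rho_metric : forall i, is_metric (@rho i).
Variable f : prod_space X -> R.
Hypothesis f_lip : rho_lipschitz rho f.

Let rho_ge0 i (y z : X i) : 0 <= rho y z.
Proof. by case: (rho_metric i). Qed.

Let rho_xx i (y : X i) : rho y y = 0.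
Proof. by case: (rho_metric i) => _ /(_ y y)[_ ->]. Qed.

Lemma local_osc_ge0 i : (0 <= local_osc rho f i)%E.
Proof.
apply: ereal_sup_ubound; exists (point, point) => //=.
by rewrite rho_xx invr0 mulr0.
Qed.

Lemma local_osc_fin_num i : local_osc rho f i \is a fin_num.
Proof.
rewrite ge0_fin_numE ?local_osc_ge0//; have [L fL] := f_lip.
(* Along coordinate [i] only one term of [rho_sum] survives; the absolute value is there because [L]
   may be negative. *)
apply: (@le_lt_trans _ _ `|L|%:E); last by rewrite ltry.
apply: ge_ereal_sup => _ [[x z] /= /restrP xz <-]; rewrite lee_fin.
have [->|r0] := eqVneq (rho (x i) (z i)) 0; first by rewrite invr0 mulr0.
rewrite ler_pdivrMr ?lt_def ?r0 ?rho_ge0//; apply: le_trans (fL x z) _.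
rewrite /rho_sum (bigD1 i)//= big1 ?addr0 => [|j ji]; last by rewrite xz ?rho_xx.
by rewrite ler_wpM2r// ler_norm.
Qed.

Lemma osc_le_local_osc : osc_le rho f (osc_vec rho f)^T.
Proof.
move=> i x z xz; rewrite !mxE; have [r0|r0] := eqVneq (rho (x i) (z i)) 0.
  by rewrite (prod_space_eq rho_metric xz r0) subrr normr0 rho_xx mulr0.
rewrite -ler_pdivrMr ?lt_def ?r0 ?rho_ge0// -lee_fin fineK ?local_osc_fin_num//.
by apply: ereal_sup_ubound; exists (x, z) => //=; exact/restrP.
Qed.

Lemma rho_lipschitz_bounded (r : 'I_n -> R) :
  (forall i (y z : X i), rho y z <= r i) -> exists M, forall x, `|f x| <= M.
Proof.
move=> hr; have [L fL] := f_lip.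
exists (`|f point| + `|L| * \sum_i r i) => x.
rewrite -[f x](subrK (f point)) addrC (le_trans (ler_normD _ _))// lerD2l.
apply: le_trans (fL _ _) _; apply: (@le_trans _ _ (`|L| * rho_sum rho x point)).
  by rewrite ler_wpM2r ?ler_norm// sumr_ge0.
by rewrite ler_wpM2l// ler_sum.
Qed.

End LocalOscillation.

Theorem corollary5p3 (R : realType) (n : nat) (X : 'I_n -> ptopologicalType)
    (rho : forall i, X i -> X i -> R)
    (mu : probability (prod_space X) R) (k : cond_laws R X)
    (hX : forall i, polish R (X i))
    (hrho : forall i, lsc_metric (rho i))
    (hdiam : forall i, (metric_diam (rho i) < +oo)%E)
    (hk : forall i, is_cond_law mu (k i))
    (hC : forall i j, (dobrushin_coef rho k i j < +oo)%E)
    (hspec : spectral_radius (dobrushin_mx rho k) < 1)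
    (f : prod_space X -> R)
    (hf : measurable_fun setT f) (hlip : rho_lipschitz rho f)
    (t : R) (ht : 0 <= t) :
  (mu [set x | t%:E <= `| (f x)%:E - 'E_mu[f] |] <=
     2%:E * expeR (- ((2 * t ^+ 2)%:E /
                      (l2norm (Gamma_mx rho k *m osc_vec rho f) ^+ 2)%:E)))%E.
Proof.
have rho_metric i : is_metric (rho i) by case: (hrho i).
pose r i := fine (metric_diam (rho i)).
have rho_le i (y z : X i) : rho i y z <= r i.
  rewrite -lee_fin fineK.
    by apply: ereal_sup_ubound; exists (y, z).
  rewrite ge0_fin_numE//; apply: ereal_sup_ubound; exists (point, point) => //=.
  by have [_ /(_ point point)[_ ->]] := rho_metric i.
have bf : bounded_measurable f.
  by split=> //; exact: rho_lipschitz_bounded rho_le.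
pose a := (osc_vec rho f)^T.
have a0 i : 0 <= a 0 i by rewrite !mxE fine_ge0// local_osc_ge0.
have fa : osc_le rho f a by exact: osc_le_local_osc.
(* The transpose in [Gamma_mx] turns the column product into the row product [a *m D], scaled
   entrywise by the diameters. *)
have VE : l2norm (Gamma_mx rho k *m osc_vec rho f) ^+ 2 =
    \sum_i (r i * (a *m neumann_mx (dobrushin_mx rho k)) 0 i) ^+ 2.
  rewrite sqr_sqrtr; last by apply: sumr_ge0 => i _; exact: sqr_ge0.
  apply: eq_bigr => i _; congr (_ ^+ 2); rewrite [LHS]mxE [in RHS]mxE mulr_sumr.
  apply: eq_bigr => j _; rewrite [Gamma_mx _ _ _ _]mxE [_^T i j]mxE [a 0 j]mxE.
  by rewrite -/(r i); ring.
have EE : ('E_mu[f] = (\int[mu]_x f x)%:E)%E.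
  by rewrite unlock -Rintegral_fineK.
rewrite VE EE.
have -> : [set x | (t%:E <= `|(f x)%:E - (\int[mu]_x f x)%:E|)%E] =
    [set x | t <= `|f x - (\int[mu]_x f x)|].
  by apply/seteqP; split=> x /=; rewrite lee_fin.
apply: chernoff_tail => //.
  by apply: sumr_ge0 => i _; exact: sqr_ge0.
exact: (mgf_bound rho_metric hC hk hspec rho_le bf a0 fa).
Qed.
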